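(* Let $\mathbb{A}=\{\mathcal{A}_1,\dots,\mathcal{A}_R\}$ be the set of optimal active sets of the multiparametric quadratic program (mpQP), each satisfying LICQ (i.e. $G_{\mathcal{A}_i}$ has full row rank), and let $\mathcal{T}$ be a storage tree of $\mathbb{A}$ with root $r$ such that for every node $i\neq r$ the set $\mathcal{A}_i$ is obtained from the active set of the parent of $i$ by adding or removing exactly one constraint. For each node $j\ne r$ let $c_j,v_j,f_j,\tilde d_j,\tilde f_j$ be the modification data of node $j$. Then for every node $i$ of $\mathcal{T}$ the parametric solution for $\theta\in CR_i$ is $$z^*(\theta)=k_r+K_r\theta+\sum_{j\in\mathrm{path}(i)}f_j\,(c_j+v_j^T\theta).$$ Furthermore, the critical region $CR_i$ is the set of parameters $\theta\in\Theta$ that satisfy $$\bar b_{\mathcal{N}_i}+\bar A_{\mathcal{N}_i}\theta+\sum_{j\in\mathrm{path}(i)}\tilde f_{j,\mathcal{N}_i}(c_j+v_j^T\theta)\preceq 0,$$ $$-\tilde q_{r,\mathcal{A}_i}-\tilde Q_{r,\mathcal{A}_i}\theta+\sum_{j\in\mathrm{path}(i)}\tilde d_{j,\mathcal{A}_i}(c_j+v_j^T\theta)\preceq 0,$$ where $\bar b=Gk_r-b$ and $\bar A=GK_r-S$.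
   Context: Problem (mpQP): for a parameter $\theta\in\Theta\subseteq\mathbb{R}^n$ ($\Theta$ a polyhedral set), minimize $\frac12 z^T H z$ over $z\in\mathbb{R}^m$ subject to $Gz\preceq b+S\theta$, where $H\in\mathbb{R}^{m\times m}$ is symmetric positive definite, $G\in\mathbb{R}^{p\times m}$, $b\in\mathbb{R}^p$, $S\in\mathbb{R}^{p\times n}$, and $\preceq$ is componentwise. Lagrange multipliers of the inequalities are denoted $\lambda\in\mathbb{R}^p$ (KKT conditions: $Hz+G^T\lambda=0$, $Gz\preceq b+S\theta$, $\lambda\succeq0$, complementary slackness). Indexing: for an index set $\mathcal{I}\subseteq\{1,\dots,p\}$, $G_{\mathcal{I}}$, $b_{\mathcal{I}}$, $S_{\mathcal{I}}$, $\bar b_{\mathcal{I}}$, $\bar A_{\mathcal{I}}$ denote the rows/entries indexed by $\mathcal{I}$ (and $G_l,b_l,S_l$ the $l$-th rows, $G_l$ and $S_l$ being row vectors); for indexed quantities such as $\tilde q_i,\tilde Q_i,\tilde d_j,\tilde f_j$, a second index denotes the corresponding entries or rows, e.g. $\tilde q_{i,\mathcal{I}}$. Optimal active set: a set $\mathcal{A}\subseteq\{1,\dots,p\}$ that, for some $\theta\in\Theta$ for which the problem is feasible, is exactly the set of constraints holding with equality at the optimum, with no weakly active constraints (the multipliers indexed by $\mathcal{A}$ are nonzero). Its complement is $\mathcal{N}=\{1,\dots,p\}\setminus\mathcal{A}$. Optimal active sets are denoted $\mathcal{A}_i$, $i=1,\dots,R$, with complements $\mathcal{N}_i$. Parametric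 solution for $\mathcal{A}_i$: the affine functions $\lambda^*(\theta)=\tilde q_i+\tilde Q_i\theta$ and $z^*(\theta)=k_i+K_i\theta$, where $\tilde q_i\in\mathbb{R}^p$, $\tilde Q_i\in\mathbb{R}^{p\times n}$ satisfy $\tilde q_{i,\mathcal{N}_i}=0$, $\tilde Q_{i,\mathcal{N}_i}=0$, $$\tilde q_{i,\mathcal{A}_i}=-(G_{\mathcal{A}_i}H^{-1}G_{\mathcal{A}_i}^T)^{-1}b_{\mathcal{A}_i},\qquad \tilde Q_{i,\mathcal{A}_i}=-(G_{\mathcal{A}_i}H^{-1}G_{\mathcal{A}_i}^T)^{-1}S_{\mathcal{A}_i},$$ and $k_i=-H^{-1}G_{\mathcal{A}_i}^T\tilde q_{i,\mathcal{A}_i}\in\mathbb{R}^m$, $K_i=-H^{-1}G_{\mathcal{A}_i}^T\tilde Q_{i,\mathcal{A}_i}\in\mathbb{R}^{m\times n}$ (all zero if $\mathcal{A}_i=\emptyset$). For $\theta\in CR_i$, $z^*(\theta)=k_i+K_i\theta$ is the optimal solution of the mpQP. Critical region of $\mathcal{A}_i$: $CR_i=\{\theta\in\Theta \mid G_{\mathcal{N}_i}(k_i+K_i\theta)\preceq b_{\mathcal{N}_i}+S_{\mathcal{N}_i}\theta,\ \tilde q_{i,\mathcal{A}_i}+\tilde Q_{i,\mathcal{A}_i}\theta\succeq0\}$. Storage tree: a rooted tree with node set $\{1,\dots,R\}$, node $i$ corresponding to $\mathcal{A}_i$, with root $r$. For a node $i$, $\mathrm{path}(i)$ is the set consisting of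 $i$ and its ancestors, with the root $r$ excluded (so $\mathrm{path}(r)=\emptyset$). Rank-one data for adding a constraint: for $\mathcal{A}\subset\{1,\dots,p\}$ and $l\notin\mathcal{A}$ with $G_{\mathcal{A}\cup\{l\}}$ of full row rank, put $W=G_{\mathcal{A}}H^{-1}G_{\mathcal{A}}^T$, $w=G_{\mathcal{A}}H^{-1}G_l^T$, $w_0=G_lH^{-1}G_l^T$, $C=w_0-w^TW^{-1}w>0$, and $$c(\mathcal{A},l)=C^{-1}(w^TW^{-1}b_{\mathcal{A}}-b_l)\in\mathbb{R},\quad v(\mathcal{A},l)=C^{-1}(S_{\mathcal{A}}^TW^{-1}w-S_l^T)\in\mathbb{R}^n;$$ let $\tilde d(\mathcal{A},l)\in\mathbb{R}^p$ have entries $W^{-1}w$ on $\mathcal{A}$, $-1$ at $l$, and $0$ elsewhere; and let $f(\mathcal{A},l)=H^{-1}G^T\tilde d(\mathcal{A},l)\in\mathbb{R}^m$. If $\mathcal{A}=\emptyset$, terms involving $W$ or $w$ are absent (zero). Modification data of a node $j\neq r$ with parent $\pi$: if $\mathcal{A}_j=\mathcal{A}_\pi\cup\{l\}$ with $l\notin\mathcal{A}_\pi$, then $(c_j,v_j,\tilde d_j,f_j)=(c,v,\tilde d,f)(\mathcal{A}_\pi,l)$; if $\mathcal{A}_j=\mathcal{A}_\pi\setminus\{l\}$ with $l\in\mathcal{A}_\pi$, then $c_j=c(\mathcal{A}_j,l)$, $v_j=v(\mathcal{A}_j,l)$, $\tilde d_j=-\tilde d(\mathcal{A}_j,l)$,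 $f_j=-f(\mathcal{A}_j,l)$. In both cases $\tilde f_j=Gf_j\in\mathbb{R}^p$. *)

(* Defs.v *)
From HB Require Import structures.
From mathcomp Require Export all_boot all_order all_algebra.
From mathcomp Require Export boolp classical_sets reals.

Set Implicit Arguments.
Unset Strict Implicit.
Unset Printing Implicit Defensive.

Import Order.TTheory GRing.Theory Num.Theory.
Local Open Scope ring_scope.

Definition vle (R : realType) (k : nat) (x y : 'cV[R]_k) : Prop :=
  forall i, x i 0 <= y i 0.

Definition dotv (R : realType) (k : nat) (x y : 'cV[R]_k) : R :=
  (x^T *m y) 0 0.

Definition polyhedral (R : realType) (n : nat) (Theta : set 'cV[R]_n) : Prop :=
  exists (q : nat) (E : 'M[R]_(q, n)) (e : 'cV[R]_q),
    Theta = [set theta | vle (E *m theta) e]%classic.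

Definition posdefmx (R : realType) (m : nat) (M : 'M[R]_m) : Prop :=
  forall z : 'cV[R]_m, z != 0 -> 0 < dotv z (M *m z).

(* M_I, with the rows listed in increasing order of their index. *)
Definition rows (R : realType) (p k : nat) (I : {set 'I_p}) (M : 'M[R]_(p, k)) :
    'M[R]_(#|I|, k) :=
  rowsub (fun a : 'I_#|I| => enum_val a) M.

(* Inverse of [rows]: the p-row matrix whose rows indexed by I are those of X
   and whose other rows vanish (the sum has at most one term). *)
Definition pad (R : realType) (p k : nat) (I : {set 'I_p}) (X : 'M[R]_(#|I|, k)) :
    'M[R]_(p, k) :=
  \matrix_(i, j) \sum_(a < #|I| | enum_val a == i) X a j.

Lemma rows_pad (R : realType) (p k : nat) (I : {set 'I_p}) (X : 'M[R]_(#|I|, k)) :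
  rows I (pad X) = X.
Proof.
apply/matrixP => a j; rewrite !mxE (bigD1 a) //= big1 ?addr0 // => a'.
by case/andP => /eqP/enum_val_inj->; rewrite eqxx.
Qed.

Lemma rows_padC (R : realType) (p k : nat) (I : {set 'I_p}) (X : 'M[R]_(#|I|, k)) :
  rows (~: I) (pad X) = 0.
Proof.
apply/matrixP => a j; rewrite !mxE big1 // => a' /eqP e.
by have := enum_valP a; rewrite inE -e enum_valP.
Qed.

Record mpQP (R : realType) (m n p : nat) := MpQP {
  qpH : 'M[R]_m;
  qpG : 'M[R]_(p, m);
  qpb : 'cV[R]_p;
  qpS : 'M[R]_(p, n);
  qpTheta : set 'cV[R]_n;
  qpH_sym : qpH^T = qpH;
  qpH_posdef : posdefmx qpH;
  qpTheta_polyhedral : polyhedral qpTheta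
}.

Definition qp_cost (R : realType) (m n p : nat) (P : mpQP R m n p)
    (z : 'cV[R]_m) : R :=
  2^-1 * dotv z (qpH P *m z).

Definition qp_feasible (R : realType) (m n p : nat) (P : mpQP R m n p)
    (theta : 'cV[R]_n) (z : 'cV[R]_m) : Prop :=
  vle (qpG P *m z) (qpb P + qpS P *m theta).

Definition qp_optimal (R : realType) (m n p : nat) (P : mpQP R m n p)
    (theta : 'cV[R]_n) (z : 'cV[R]_m) : Prop :=
  qp_feasible P theta z /\
  (forall z', qp_feasible P theta z' -> qp_cost P z <= qp_cost P z').

Definition KKT (R : realType) (m n p : nat) (P : mpQP R m n p)
    (theta : 'cV[R]_n) (z : 'cV[R]_m) (lambda : 'cV[R]_p) : Prop :=
  [/\ qpH P *m z + (qpG P)^T *m lambda = 0,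
      qp_feasible P theta z,
      vle 0 lambda &
      forall i, lambda i 0 * (qpG P *m z - (qpb P + qpS P *m theta)) i 0 = 0].

Definition active_at (R : realType) (m n p : nat) (P : mpQP R m n p)
    (theta : 'cV[R]_n) (z : 'cV[R]_m) : {set 'I_p} :=
  [set i | (qpG P *m z) i 0 == (qpb P + qpS P *m theta) i 0]%SET.

Definition optimal_active_set (R : realType) (m n p : nat) (P : mpQP R m n p)
    (A : {set 'I_p}) : Prop :=
  exists (theta : 'cV[R]_n) (z : 'cV[R]_m) (lambda : 'cV[R]_p),
    [/\ qpTheta P theta, qp_optimal P theta z, KKT P theta z lambda,
        A = active_at P theta z & forall i, i \in A -> lambda i 0 != 0].

Definition LICQ (R : realType) (m n p : nat) (P : mpQP R m n p)
    (A : {set 'I_p}) : bool :=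
  row_free (rows A (qpG P)).

Definition Wmx (R : realType) (m n p : nat) (P : mpQP R m n p)
    (A : {set 'I_p}) : 'M[R]_#|A| :=
  rows A (qpG P) *m invmx (qpH P) *m (rows A (qpG P))^T.

(* The parametric solution: multiplier [par_q + par_Q *m theta], optimizer
   [par_k + par_K *m theta].  For A = set0 all four are 0. *)
Definition par_q (R : realType) (m n p : nat) (P : mpQP R m n p)
    (A : {set 'I_p}) : 'cV[R]_p :=
  pad (- (invmx (Wmx P A) *m rows A (qpb P))).

Definition par_Q (R : realType) (m n p : nat) (P : mpQP R m n p)
    (A : {set 'I_p}) : 'M[R]_(p, n) :=
  pad (- (invmx (Wmx P A) *m rows A (qpS P))).

Definition par_k (R : realType) (m n p : nat) (P : mpQP R m n p)
    (A : {set 'I_p}) : 'cV[R]_m :=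
  - (invmx (qpH P) *m (rows A (qpG P))^T *m rows A (par_q P A)).

Definition par_K (R : realType) (m n p : nat) (P : mpQP R m n p)
    (A : {set 'I_p}) : 'M[R]_(m, n) :=
  - (invmx (qpH P) *m (rows A (qpG P))^T *m rows A (par_Q P A)).

Definition critical_region (R : realType) (m n p : nat) (P : mpQP R m n p)
    (A : {set 'I_p}) : set 'cV[R]_n :=
  [set theta |
    [/\ qpTheta P theta,
        vle (rows (~: A) (qpG P) *m (par_k P A + par_K P A *m theta))
            (rows (~: A) (qpb P) + rows (~: A) (qpS P) *m theta) &
        vle 0 (rows A (par_q P A) + rows A (par_Q P A) *m theta)]]%classic.

Definition add_w (R : realType) (m n p : nat) (P : mpQP R m n p)
    (A : {set 'I_p}) (l : 'I_p) : 'cV[R]_#|A| :=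
  rows A (qpG P) *m invmx (qpH P) *m (row l (qpG P))^T.

Definition add_C (R : realType) (m n p : nat) (P : mpQP R m n p)
    (A : {set 'I_p}) (l : 'I_p) : R :=
  (row l (qpG P) *m invmx (qpH P) *m (row l (qpG P))^T) 0 0
  - ((add_w P A l)^T *m invmx (Wmx P A) *m add_w P A l) 0 0.

Definition add_c (R : realType) (m n p : nat) (P : mpQP R m n p)
    (A : {set 'I_p}) (l : 'I_p) : R :=
  (add_C P A l)^-1
  * (((add_w P A l)^T *m invmx (Wmx P A) *m rows A (qpb P)) 0 0 - qpb P l 0).

Definition add_v (R : realType) (m n p : nat) (P : mpQP R m n p)
    (A : {set 'I_p}) (l : 'I_p) : 'cV[R]_n :=
  (add_C P A l)^-1
  *: ((rows A (qpS P))^T *m invmx (Wmx P A) *m add_w P A l - (row l (qpS P))^T).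

(* Only used for l \notin A, where the entry at l is -1. *)
Definition add_d (R : realType) (m n p : nat) (P : mpQP R m n p)
    (A : {set 'I_p}) (l : 'I_p) : 'cV[R]_p :=
  pad (invmx (Wmx P A) *m add_w P A l) - delta_mx l 0.

Definition add_f (R : realType) (m n p : nat) (P : mpQP R m n p)
    (A : {set 'I_p}) (l : 'I_p) : 'cV[R]_m :=
  invmx (qpH P) *m (qpG P)^T *m add_d P A l.

(* A rooted tree on the node set 'I_N given by its parent function; the root is
   its own parent by convention. *)
Definition rooted_tree (N : nat) (parent : 'I_N -> 'I_N) (r : 'I_N) : Prop :=
  parent r = r /\ (forall i, fconnect parent i r).

Definition tree_path (N : nat) (parent : 'I_N -> 'I_N) (r i : 'I_N) : {set 'I_N} :=
  [set j | (j != r) && fconnect parent i j]%SET.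

Definition one_constraint_step (p : nat) (Apar A : {set 'I_p}) : Prop :=
  (exists l, l \notin Apar /\ A = l |: Apar) \/
  (exists l, l \in Apar /\ A = Apar :\ l).

Definition modification_data (R : realType) (m n p : nat) (P : mpQP R m n p)
    (Apar A : {set 'I_p}) (c : R) (v : 'cV[R]_n) (d : 'cV[R]_p) (f : 'cV[R]_m)
    (ft : 'cV[R]_p) : Prop :=
  [/\ forall l, l \notin Apar -> A = l |: Apar ->
        [/\ c = add_c P Apar l, v = add_v P Apar l,
            d = add_d P Apar l & f = add_f P Apar l],
      forall l, l \in Apar -> A = Apar :\ l ->
        [/\ c = add_c P A l, v = add_v P A l,
            d = - add_d P A l & f = - add_f P A l] &
      ft = qpG P *m f].

(* Main.v *)
(** Write [M = G H^-1 G^T].  Under LICQ the multiplier [lambda = q + Q theta] of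
    an active set [A] is the only vector supported in [A] such that
    [(M lambda)_i = - (b + S theta)_i] for all [i] in [A], and the optimizer is
    [z = - H^-1 G^T lambda].  The direction [d] attached to [(A, l)] satisfies
    [(M d)_i = 0] on [A] and [(M d)_l = - C]; hence [lambda - (c + v^T theta) d]
    has the property that characterizes the multiplier of [l |: A].  Removing a
    constraint is the same identity read backwards, and summing the updates along
    the path to the root gives both formulas. *)
Require Import Defs.

Set Implicit Arguments.
Unset Strict Implicit.
Unset Printing Implicit Defensive.

Import Order.TTheory GRing.Theory Num.Theory.
Local Open Scope ring_scope.

(** * Row selection and padding by zero rows *)

Section Padding.
Variables (R : realType) (p : nat) (I : {set 'I_p}).

Lemma rows_mul k q (M : 'M[R]_(p, k)) (X : 'M[R]_(k, q)) :
  rows I (M *m X) = rows I M *m X.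
Proof. by rewrite /rows mul_rowsub_mx. Qed.

Lemma rowsD k (M X : 'M[R]_(p, k)) : rows I (M + X) = rows I M + rows I X.
Proof. by apply/matrixP => a j; rewrite !mxE. Qed.

Lemma rowsN k (M : 'M[R]_(p, k)) : rows I (- M) = - rows I M.
Proof. by apply/matrixP => a j; rewrite !mxE. Qed.

Lemma rowsZ k (t : R) (M : 'M[R]_(p, k)) : rows I (t *: M) = t *: rows I M.
Proof. by apply/matrixP => a j; rewrite !mxE. Qed.

Lemma rows_sum k (J : finType) (Q : pred J) (F : J -> 'M[R]_(p, k)) :
  rows I (\sum_(j | Q j) F j) = \sum_(j | Q j) rows I (F j).
Proof.
by apply/matrixP => a j; rewrite !(summxE, mxE); apply: eq_bigr => s _; rewrite mxE.
Qed.

(** Only the columns of [B] indexed by [I] meet nonzero rows of [pad X]. They are written as rows of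
    [B^T] so that [B = G^T] gives back [rows I G]. *)
Lemma mul_mx_pad k q (B : 'M[R]_(k, p)) (X : 'M[R]_(#|I|, q)) :
  B *m pad X = (rows I B^T)^T *m X.
Proof.
apply/matrixP => i j; rewrite !mxE.
under eq_bigr => s _ do rewrite mxE big_distrr /= big_mkcond.
rewrite exchange_big /=; apply: eq_bigr => a _.
by rewrite -big_mkcond (big_pred1 (enum_val a)) ?mxE // => s; rewrite eq_sym.
Qed.

Lemma pad_out k (X : 'M[R]_(#|I|, k)) i j : i \notin I -> pad X i j = 0.
Proof.
move=> iI; rewrite mxE big1 // => a /eqP e.
by move: iI; rewrite -e enum_valP.
Qed.

Lemma rows_inj k (x y : 'M[R]_(p, k)) i j :
  rows I x = rows I y -> i \in I -> x i j = y i j.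
Proof.
move=> e iI; move/matrixP/(_ (enum_rank_in iI i) j): e.
by rewrite !mxE enum_rankK_in.
Qed.

Lemma pad_rows k (x : 'M[R]_(p, k)) :
  (forall i j, i \notin I -> x i j = 0) -> pad (rows I x) = x.
Proof.
move=> x0; apply/matrixP => i j; case: (boolP (i \in I)) => iI.
  by apply: rows_inj (iI); rewrite rows_pad.
by rewrite pad_out // x0.
Qed.

Lemma padD k (X Y : 'M[R]_(#|I|, k)) : pad (X + Y) = pad X + pad Y.
Proof.
by apply/matrixP => i j; rewrite !mxE -big_split; apply: eq_bigr => a _; rewrite mxE.
Qed.

Lemma pad_mul k q (X : 'M[R]_(#|I|, k)) (Y : 'M[R]_(k, q)) :
  pad X *m Y = pad (X *m Y).
Proof.
apply/matrixP => i j; rewrite !mxE.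
under eq_bigr => s _ do rewrite mxE big_distrl.
by rewrite exchange_big; apply: eq_bigr => a _; rewrite mxE.
Qed.

End Padding.

(** * Entries, inner product and order of column vectors *)

Section ColumnVectors.
Variables (R : realType) (k : nat).
Implicit Types x y : 'cV[R]_k.

Lemma sub_colE x y i : (x - y) i 0 = x i 0 - y i 0.
Proof. by rewrite !mxE. Qed.

Lemma scale_colE t x i : (t *: x) i 0 = t * x i 0.
Proof. by rewrite mxE. Qed.

Lemma dotvC x y : dotv x y = dotv y x.
Proof. by rewrite /dotv -[x^T *m y]trmxK trmx_mul trmxK mxE. Qed.

Lemma vle_sub0 x y : vle x y <-> vle (x - y) 0.
Proof. by split=> h i; have := h i; rewrite sub_colE mxE subr_le0. Qed.

Lemma vle0_opp x : vle 0 x <-> vle (- x) 0.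
Proof. by split=> h i; have := h i; rewrite !mxE oppr_le0. Qed.

End ColumnVectors.

(** * Positive definite matrices and their inverses *)

Section PositiveDefinite.
Variables (R : realType) (m : nat) (M : 'M[R]_m).

Lemma posdefmx_unit : posdefmx M -> M \in unitmx.
Proof.
move=> pM; rewrite -row_free_unit; apply/inj_row_free => x xM0.
apply/eqP/negPn/negP => x0; have := pM x^T.
rewrite -trmx0 (inj_eq trmx_inj) => /(_ x0).
by rewrite /dotv trmxK mulmxA xM0 mul0mx mxE ltxx.
Qed.

(** With [y = invmx M *m z], which is nonzero, symmetry turns [z^T M^-1 z] into [y^T M y]. *)
Lemma posdefmx_inv : M^T = M -> posdefmx M -> posdefmx (invmx M).
Proof.
move=> sM pM z z0; have uM := posdefmx_unit pM.
have /pM : invmx M *m z != 0.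
  by apply: contraNneq z0 => e; rewrite -[z](mulKVmx uM) e mulmx0.
by rewrite /dotv trmx_mul trmx_inv sM (mulKVmx uM) -mulmxA.
Qed.

Lemma posdefmx_ge0 (z : 'cV[R]_m) : posdefmx M -> 0 <= dotv z (M *m z).
Proof.
move=> pM; case: (eqVneq z 0) => [->|/pM/ltW //].
by rewrite /dotv mulmx0 mulmx0 mxE.
Qed.

Lemma posdefmx_le0 (z : 'cV[R]_m) : posdefmx M -> dotv z (M *m z) <= 0 -> z = 0.
Proof. by move=> pM; case: (eqVneq z 0) => // /pM; rewrite ltNge => /negP. Qed.

End PositiveDefinite.

(** * Characterization of multipliers and their rank-one update *)

Section Multiplier.
Variables (R : realType) (m n p : nat) (P : mpQP R m n p).

(** The Hessian, up to sign, of the dual objective, obtained by eliminating [z] through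
    stationarity. *)
Definition dual_hessian : 'M[R]_p := qpG P *m invmx (qpH P) *m (qpG P)^T.

Definition multiplier (A : {set 'I_p}) (theta : 'cV[R]_n) : 'cV[R]_p :=
  par_q P A + par_Q P A *m theta.

(** The second clause says that [z = - H^-1 G^T x] makes the constraints of [A] tight. No sign is
    imposed, so the notion makes sense for every [theta], inside the critical region or not. *)
Definition is_multiplier (A : {set 'I_p}) (theta : 'cV[R]_n) (x : 'cV[R]_p) : Prop :=
  (forall i, i \notin A -> x i 0 = 0) /\
  (forall i, i \in A ->
     (dual_hessian *m x) i 0 = - (qpb P + qpS P *m theta) i 0).

Lemma posdefmx_invH : posdefmx (invmx (qpH P)).
Proof. by apply: posdefmx_inv; [apply: qpH_sym | apply: qpH_posdef]. Qed.

Lemma rows_dual_pad (A : {set 'I_p}) k (X : 'M[R]_(#|A|, k)) :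
  rows A (dual_hessian *m pad X) = Wmx P A *m X.
Proof. by rewrite -mulmxA mul_mx_pad trmxK !rows_mul /Wmx !mulmxA. Qed.

(** Each term of [x^T M x] has a zero factor, so definiteness of [H^-1] gives [G^T x = 0]; full row
    rank of [G_A] then forces [x = 0]. *)
Lemma supported_kernel0 (A : {set 'I_p}) (x : 'cV[R]_p) : LICQ P A ->
  (forall i, i \notin A -> x i 0 = 0) ->
  (forall i, i \in A -> (dual_hessian *m x) i 0 = 0) -> x = 0.
Proof.
move=> licq x0 Mx0.
have xE : pad (rows A x) = x.
  by apply: pad_rows => i j; rewrite ord1; apply: x0.
have Gx0 : (qpG P)^T *m x = 0.
  apply: (posdefmx_le0 posdefmx_invH).
  suff -> : dotv ((qpG P)^T *m x) (invmx (qpH P) *m ((qpG P)^T *m x)) = 0 by [].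
  rewrite /dotv trmx_mul trmxK !mulmxA -2!(mulmxA x^T) -mulmxA mxE big1 // => i _.
  case: (boolP (i \in A)) => iA; first by rewrite Mx0 ?mulr0.
  by rewrite mxE x0 ?mul0r.
suff e : rows A x = 0.
  by rewrite -xE e; apply/matrixP => i j; rewrite !mxE big1 // => a _; rewrite mxE.
have := Gx0; rewrite -xE mul_mx_pad trmxK => /(congr1 trmx).
rewrite trmx_mul trmxK trmx0 rows_pad => e.
by apply: trmx_inj; apply: (row_free_inj licq); rewrite e trmx0 mul0mx.
Qed.

(** A kernel vector of [Wmx P A], padded by zeros, falls under [supported_kernel0]. *)
Lemma Wmx_unit (A : {set 'I_p}) : LICQ P A -> Wmx P A \in unitmx.
Proof.
move=> licq; rewrite -unitmx_tr -row_free_unit; apply/inj_row_free => x xW0.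
apply: trmx_inj; rewrite trmx0.
have Wx0 : Wmx P A *m x^T = 0.
  by apply: trmx_inj; rewrite trmx_mul trmxK xW0 trmx0.
have px0 : pad x^T = 0.
  apply: (supported_kernel0 licq) => i iA; first exact: pad_out.
  rewrite (@rows_inj _ _ A _ _ 0 _ _ _ iA) ?mxE // rows_dual_pad Wx0.
  by apply/matrixP => a j; rewrite !mxE.
by rewrite -(rows_pad x^T) px0; apply/matrixP => a j; rewrite !mxE.
Qed.

Lemma multiplierE (A : {set 'I_p}) theta :
  multiplier A theta =
    pad (- (invmx (Wmx P A) *m rows A (qpb P + qpS P *m theta))).
Proof.
rewrite /multiplier /par_q /par_Q pad_mul -padD rowsD rows_mul.
by rewrite mulmxDr mulNmx -mulmxA opprD.
Qed.

Lemma multiplierP (A : {set 'I_p}) theta :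
  LICQ P A -> is_multiplier A theta (multiplier A theta).
Proof.
move=> licq; rewrite multiplierE; split => i iA; first exact: pad_out.
rewrite (@rows_inj _ _ A _ _ (- (qpb P + qpS P *m theta)) _ _ _ iA) 1?mxE //.
by rewrite rows_dual_pad mulmxN mulKVmx ?Wmx_unit // rowsN.
Qed.

(** This replaces block inversion of [Wmx P (l |: A)]: an updated vector only has to be checked
    against [is_multiplier]. *)
Lemma is_multiplier_unique (A : {set 'I_p}) theta x : LICQ P A ->
  is_multiplier A theta x -> x = multiplier A theta.
Proof.
move=> licq [x0 xA]; have [y0 yA] := multiplierP theta licq.
apply/subr0_eq/(supported_kernel0 licq) => i iA.
  by rewrite sub_colE x0 // y0 // subr0.
by rewrite mulmxBr sub_colE xA // yA // subrr.
Qed.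

Lemma add_d_out (A : {set 'I_p}) l i :
  i \notin l |: A -> add_d P A l i 0 = 0.
Proof.
rewrite in_setU1 negb_or => /andP[il iA]; rewrite sub_colE pad_out // mxE.
by rewrite (negbTE il) subr0.
Qed.

Lemma add_d_at (A : {set 'I_p}) l : l \notin A -> add_d P A l l 0 = -1.
Proof. by move=> lA; rewrite sub_colE pad_out // mxE !eqxx sub0r. Qed.

Lemma dual_delta l :
  dual_hessian *m delta_mx l 0 = qpG P *m invmx (qpH P) *m (row l (qpG P))^T.
Proof. by rewrite tr_row colE mulmxA. Qed.

Lemma dual_add_d_in (A : {set 'I_p}) l i : LICQ P A -> i \in A ->
  (dual_hessian *m add_d P A l) i 0 = 0.
Proof.
move=> licq iA; rewrite (@rows_inj _ _ A _ _ 0 _ _ _ iA) ?mxE //.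
rewrite mulmxBr rowsD rowsN rows_dual_pad mulKVmx ?Wmx_unit // dual_delta.
by rewrite !rows_mul subrr; apply/matrixP => a j; rewrite !mxE.
Qed.

(** By symmetry of [H], row [l] of [M] restricted to [A] is the transpose of [add_w P A l]. *)
Lemma row_dual_pad (A : {set 'I_p}) l (X : 'cV[R]_#|A|) :
  (dual_hessian *m pad X) l 0 = ((add_w P A l)^T *m X) 0 0.
Proof.
have -> : (dual_hessian *m pad X) l 0 = (row l (dual_hessian *m pad X)) 0 0.
  by rewrite [RHS]mxE.
rewrite -mulmxA mul_mx_pad trmxK !row_mul /add_w !trmx_mul trmxK trmx_inv qpH_sym.
by rewrite !mulmxA.
Qed.

Lemma dual_add_d_at (A : {set 'I_p}) l :
  (dual_hessian *m add_d P A l) l 0 = - add_C P A l.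
Proof.
rewrite mulmxBr sub_colE row_dual_pad dual_delta mulmxA /add_C opprB.
by congr (_ - _); rewrite -!row_mul [RHS]mxE.
Qed.

(* If C vanished, the direction d would be a nonzero kernel vector supported in
   [l |: A]. *)
Lemma add_C_neq0 (A : {set 'I_p}) l : l \notin A ->
  LICQ P A -> LICQ P (l |: A) -> add_C P A l != 0.
Proof.
move=> lA licq licq'; apply/eqP => C0.
have /matrixP/(_ l 0) : add_d P A l = 0.
  apply: (supported_kernel0 licq') => i; first exact: add_d_out.
  case/setU1P => [->|iA]; first by rewrite dual_add_d_at C0 oppr0.
  exact: dual_add_d_in.
by rewrite add_d_at // mxE => /eqP; rewrite oppr_eq0 oner_eq0.
Qed.

(** Up to the factor [C^-1], the coefficient is the residual of constraint [l] at the optimizer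
    attached to [A]. *)
Lemma add_c_vE (A : {set 'I_p}) l theta :
  add_c P A l + dotv (add_v P A l) theta =
  (add_C P A l)^-1 *
    (((add_w P A l)^T *m (invmx (Wmx P A) *m rows A (qpb P + qpS P *m theta))) 0 0
     - (qpb P + qpS P *m theta) l 0).
Proof.
have Wsym : (Wmx P A)^T = Wmx P A.
  by rewrite /Wmx !trmx_mul trmxK trmx_inv qpH_sym mulmxA.
have Sl : row l (qpS P) *m theta = row l (qpS P *m theta) by rewrite row_mul.
rewrite /add_c /add_v /dotv linearZ /= -scalemxAl [X in _ + X]mxE -mulrDr.
congr (_ * _); move: (add_w P A l) => w; rewrite linearB /= !trmx_mul !trmxK trmx_inv Wsym mulmxBl Sl.
rewrite rowsD rows_mul !mulmxDr !mulmxA.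
by rewrite !mxE opprD addrACA.
Qed.

Lemma multiplier_add (A : {set 'I_p}) l theta : l \notin A ->
  LICQ P A -> LICQ P (l |: A) ->
  multiplier (l |: A) theta =
  multiplier A theta - (add_c P A l + dotv (add_v P A l) theta) *: add_d P A l.
Proof.
move=> lA licq licq'; apply/esym/(is_multiplier_unique licq').
have [x0 xA] := multiplierP theta licq; split => i.
  move=> iA; rewrite sub_colE scale_colE add_d_out // mulr0 subr0 x0 //.
  by apply: contra iA; apply: setU1r.
rewrite mulmxBr -scalemxAr sub_colE scale_colE => /setU1P[->|iA]; last first.
  by rewrite dual_add_d_in // mulr0 subr0 xA.
(* At row [l] the factor [C] cancels, then so do the terms in [w], leaving [- (b + S theta)_l]. *)
rewrite dual_add_d_at add_c_vE mulrN opprK mulrAC mulVf ?add_C_neq0 // mul1r.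
by rewrite multiplierE row_dual_pad mulmxN mxE addKr.
Qed.

(** The multiplier vanishes off [A], so the full [G] may replace [G_A]. The optimizer is then one
    linear map, the same for all active sets, applied to the multiplier, and updates of the latter
    carry over. *)
Lemma par_kKE (A : {set 'I_p}) theta :
  par_k P A + par_K P A *m theta =
  - (invmx (qpH P) *m (qpG P)^T *m multiplier A theta).
Proof.
have GA k (Y : 'M[R]_(#|A|, k)) : invmx (qpH P) *m (qpG P)^T *m pad Y
    = invmx (qpH P) *m (rows A (qpG P))^T *m Y.
  by rewrite -!mulmxA mul_mx_pad trmxK.
rewrite /par_k /par_K /multiplier /par_q /par_Q !rows_pad pad_mul mulmxDr !GA.
by rewrite opprD mulNmx; congr (_ - _); rewrite mulmxA.
Qed.

End Multiplier.

(** * Sufficiency of the KKT conditions, and the update along one tree edge *)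

Section Optimality.
Variables (R : realType) (m n p : nat) (P : mpQP R m n p).

Lemma qp_costD (z e : 'cV[R]_m) :
  qp_cost P (z + e) = qp_cost P z + dotv e (qpH P *m z) + qp_cost P e.
Proof.
have sym : dotv z (qpH P *m e) = dotv e (qpH P *m z).
  by rewrite dotvC /dotv trmx_mul qpH_sym mulmxA.
have De : dotv (z + e) (qpH P *m (z + e)) =
    dotv z (qpH P *m z) + 2 * dotv e (qpH P *m z) + dotv e (qpH P *m e).
  rewrite mulr_natl mulr2n -{1}sym /dotv linearD /= mulmxDl !mulmxDr !mxE.
  by rewrite !addrA.
by rewrite /qp_cost De mulrDr mulrDr mulKf // pnatr_eq0.
Qed.

(** For feasible [z'] the linear term of the cost expansion at [z] is [lambda^T (G z - G z')],
    nonnegative by complementarity. Hence the cost grows by at least [qp_cost P (z' - z)], which is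
    positive unless [z' = z]. *)
Lemma KKT_optimal (theta : 'cV[R]_n) z lambda :
  KKT P theta z lambda -> forall z', qp_optimal P theta z' <-> z' = z.
Proof.
case=> stat feas lam0 compl.
have cost_ge z' : qp_feasible P theta z' ->
    qp_cost P z + qp_cost P (z' - z) <= qp_cost P z'.
  move=> feas'; rewrite -[X in _ <= qp_cost P X](subrKC z z') [leRHS]qp_costD lerD2r lerDl.
  have -> : qpH P *m z = - ((qpG P)^T *m lambda) by apply/eqP; rewrite -addr_eq0 stat.
  rewrite dotvC /dotv linearN /= trmx_mul trmxK mulNmx -mulmxN -mulmxA.
  rewrite mulmxN mulmxBr opprB mxE; apply: sumr_ge0 => i _.
  have -> : qpG P *m z - qpG P *m z' = (qpG P *m z - (qpb P + qpS P *m theta))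
      - (qpG P *m z' - (qpb P + qpS P *m theta)) by rewrite opprB addrA subrK.
  rewrite mxE sub_colE mulrBr compl sub0r -mulrN mulr_ge0 //.
    by have := lam0 i; rewrite mxE.
  by rewrite sub_colE oppr_ge0 subr_le0; apply: feas'.
move=> z'; split=> [[feas' opt']|->].
  apply/subr0_eq/(posdefmx_le0 (qpH_posdef P)).
  have := le_trans (cost_ge _ feas') (opt' _ feas).
  by rewrite gerDl /qp_cost pmulr_rle0 // invr_gt0 ltr0n.
split=> // y /cost_ge; apply: le_trans.
by rewrite lerDl mulr_ge0 ?invr_ge0 ?ler0n ?posdefmx_ge0 //; apply: qpH_posdef.
Qed.

(** The region supplies feasibility off [A] and the sign of the multiplier on [A]; [is_multiplier]
    supplies tightness on [A] and zeros elsewhere. Together these are the KKT conditions. *)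
Lemma critical_region_optimal (A : {set 'I_p}) theta : LICQ P A ->
  critical_region P A theta ->
  forall z, qp_optimal P theta z <-> z = par_k P A + par_K P A *m theta.
Proof.
move=> licq [_ feasN lamA]; apply: (@KKT_optimal _ _ (multiplier P A theta)).
have [lam0 GA] := multiplierP theta licq.
have uH := posdefmx_unit (qpH_posdef P).
have actA i : i \in A -> (qpG P *m (par_k P A + par_K P A *m theta)) i 0
    = (qpb P + qpS P *m theta) i 0.
  by move=> iA; rewrite par_kKE mulmxN !mulmxA mxE GA // opprK.
split.
- by rewrite par_kKE mulmxN -!mulmxA mulKVmx // addNr.
- move=> i; case: (boolP (i \in A)) => iA; first by rewrite actA.
  have iN : i \in ~: A by rewrite inE.
  move: feasN => /(_ (enum_rank_in iN i)); rewrite -!rows_mul -rowsD.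
  by rewrite !mxE enum_rankK_in.
- move=> i; rewrite [X in X <= _]mxE.
  case: (boolP (i \in A)) => iA; last by rewrite lam0.
  move: lamA => /(_ (enum_rank_in iA i)); rewrite -!rows_mul -rowsD.
  by rewrite !mxE enum_rankK_in.
- move=> i; case: (boolP (i \in A)) => iA; last by rewrite lam0 // mul0r.
  by rewrite sub_colE actA // subrr mulr0.
Qed.

Lemma modification_step (Apar A : {set 'I_p}) c v d f ft :
  one_constraint_step Apar A -> LICQ P Apar -> LICQ P A ->
  modification_data P Apar A c v d f ft ->
  (forall theta,
     multiplier P A theta = multiplier P Apar theta - (c + dotv v theta) *: d) /\
  f = invmx (qpH P) *m (qpG P)^T *m d.
Proof.
move=> step licqp licq [dataU dataD _].
case: step => -[l [lA AE]].
  have [-> -> -> ->] := dataU l lA AE; split=> // theta.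
  by rewrite AE multiplier_add // -AE.
have [-> -> -> ->] := dataD l lA AE; split=> [theta|]; last by rewrite mulmxN.
(* For a removal, [A] is the smaller set. Solving [multiplier_add] for its multiplier produces the
   sign flip of [d] and [f]. *)
have AparE : Apar = l |: A by rewrite AE finset.setD1K.
have lnA : l \notin A by rewrite AE !inE eqxx.
rewrite AparE in licqp *.
by rewrite multiplier_add // scalerN opprK subrK.
Qed.

End Optimality.

(** * Paths and induction in a rooted tree *)

Section TreePath.
Variables (N : nat) (parent : 'I_N -> 'I_N) (r : 'I_N).
Hypothesis tree : rooted_tree parent r.

Lemma iter_parent_root k : iter k parent r = r.
Proof. by case: tree => rr _; elim: k => //= k ->. Qed.

Lemma tree_path_root : tree_path parent r r = finset.set0.
Proof.
apply/setP => j; rewrite !inE; apply/negP => /andP[jr /iter_findex].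
by rewrite iter_parent_root => e; rewrite e eqxx in jr.
Qed.

Lemma parent_acyclic i : i != r -> ~~ fconnect parent (parent i) i.
Proof.
apply: contra => /iter_findex; set s := findex _ _ _; rewrite -iterSr => loop.
have cyc k : iter (k * s.+1) parent i = i.
  by elim: k => // k IH; rewrite mulSn iterD IH.
have [_ /(_ i)/iter_findex] := tree; set k := findex _ _ _ => toroot.
(* Going round the cycle [k] times takes at least [k] parent steps, so it ends at the fixed point
   [r], yet it also ends at [i]. *)
by rewrite -(cyc k) mulnS addnC iterD toroot iter_parent_root.
Qed.

(** Acyclicity makes the union disjoint, so a sum over the path gains exactly one term per edge. *)
Lemma tree_path_parent i : i != r ->
  i \notin tree_path parent r (parent i) /\
  tree_path parent r i = i |: tree_path parent r (parent i).
Proof.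
move=> ir; split; first by rewrite inE ir parent_acyclic.
apply/setP => j; rewrite !inE fconnect_eqVf (eq_sym i j).
by case: (eqVneq j i) => [->|_] //=; rewrite ir.
Qed.

(** Induction on a number of parent steps leading to [r]. *)
Lemma tree_ind (Q : 'I_N -> Prop) :
  Q r -> (forall i, i != r -> Q (parent i) -> Q i) -> forall i, Q i.
Proof.
move=> Qr Qs i; have [_ /(_ i)/iter_findex] := tree.
move: (findex parent i r) => k; elim: k i => [i /= -> //|k IH i].
rewrite iterSr => /IH Qp; case: (eqVneq i r) => [-> //|ir]; exact: Qs.
Qed.

End TreePath.

Theorem theorem3 (R : realType) (m n p : nat) (P : mpQP R m n p)
    (N : nat) (A : 'I_N -> {set 'I_p})
    (hAinj : injective A)
    (hA : forall X : {set 'I_p}, optimal_active_set P X <-> exists i, A i = X)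
    (hLICQ : forall i, LICQ P (A i))
    (parent : 'I_N -> 'I_N) (r : 'I_N)
    (htree : rooted_tree parent r)
    (hstep : forall i, i != r -> one_constraint_step (A (parent i)) (A i))
    (c : 'I_N -> R) (v : 'I_N -> 'cV[R]_n) (d : 'I_N -> 'cV[R]_p)
    (f : 'I_N -> 'cV[R]_m) (ft : 'I_N -> 'cV[R]_p)
    (hdata : forall j, j != r ->
       modification_data P (A (parent j)) (A j) (c j) (v j) (d j) (f j) (ft j))
    (bbar : 'cV[R]_p) (hbbar : bbar = qpG P *m par_k P (A r) - qpb P)
    (Abar : 'M[R]_(p, n)) (hAbar : Abar = qpG P *m par_K P (A r) - qpS P)
    (i : 'I_N) :
  (forall theta : 'cV[R]_n, critical_region P (A i) theta ->
     let zstar := par_k P (A r) + par_K P (A r) *m theta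
       + \sum_(j in tree_path parent r i) (c j + dotv (v j) theta) *: f j in
     par_k P (A i) + par_K P (A i) *m theta = zstar /\
     (forall z : 'cV[R]_m, qp_optimal P theta z <-> z = zstar)) /\
  critical_region P (A i) =
    [set theta : 'cV[R]_n |
      [/\ qpTheta P theta,
          vle (rows (~: A i) bbar + rows (~: A i) Abar *m theta
               + \sum_(j in tree_path parent r i)
                   (c j + dotv (v j) theta) *: rows (~: A i) (ft j)) 0 &
          vle (- rows (A i) (par_q P (A r)) - rows (A i) (par_Q P (A r)) *m theta
               + \sum_(j in tree_path parent r i)
                   (c j + dotv (v j) theta) *: rows (A i) (d j)) 0]]%classic.
Proof.
pose t j theta := c j + dotv (v j) theta.
have stepE j (jr : j != r) := modification_step (hstep _ jr)
  (hLICQ (parent j)) (hLICQ j) (hdata _ jr).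
(* This holds for every [theta], not only in the critical region, as the set equality requires. *)
have multE theta : multiplier P (A i) theta = multiplier P (A r) theta
    - \sum_(j in tree_path parent r i) t j theta *: d j.
  elim/(tree_ind htree): (i) => [|j jr IH].
    by rewrite (tree_path_root htree) big_set0 subr0.
  have [jnot ->] := tree_path_parent htree jr.
  by rewrite big_setU1 //= (stepE j jr).1 IH addrAC -addrA -opprD.
have optE theta : par_k P (A i) + par_K P (A i) *m theta =
    par_k P (A r) + par_K P (A r) *m theta
    + \sum_(j in tree_path parent r i) t j theta *: f j.
  rewrite !par_kKE multE mulmxBr opprB addrC; congr (_ + _).
  rewrite mulmx_sumr; apply: eq_bigr => j; rewrite inE => /andP[jr _].
  by rewrite (stepE j jr).2 -scalemxAr.
split=> [theta crit|].
  by split=> [|z]; rewrite -?optE //; apply: critical_region_optimal.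
(* The left side of the first inequality is exactly the residual, off [A i], of the optimizer
   attached to [A i]. *)
have primalE theta : rows (~: A i) bbar + rows (~: A i) Abar *m theta
    + \sum_(j in tree_path parent r i) t j theta *: rows (~: A i) (ft j) =
    rows (~: A i) (qpG P) *m (par_k P (A i) + par_K P (A i) *m theta)
    - (rows (~: A i) (qpb P) + rows (~: A i) (qpS P) *m theta).
  rewrite -!rows_mul -!rowsD -rowsN -rowsD optE.
  rewrite (eq_bigr (fun j => rows (~: A i) (t j theta *: (qpG P *m f j)))); last first.
    by move=> j; rewrite inE => /andP[/hdata[_ _ ->] _]; rewrite rowsZ.
  rewrite -rows_sum -rowsD; congr rows.
  under eq_bigr do rewrite scalemxAr.
  rewrite -mulmx_sumr hbbar hAbar mulmxBl !mulmxDr -mulmxA.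
  by rewrite opprD [in LHS]addrACA [LHS]addrAC.
(* The left side of the second is minus the multiplier on [A i], which turns nonnegativity into an
   upper bound by 0. *)
have dualE theta : - rows (A i) (par_q P (A r)) - rows (A i) (par_Q P (A r)) *m theta
    + \sum_(j in tree_path parent r i) t j theta *: rows (A i) (d j) =
    - (rows (A i) (par_q P (A i)) + rows (A i) (par_Q P (A i)) *m theta).
  rewrite -!rows_mul -rowsD -/(multiplier P (A i) theta) multE -opprD -rowsD.
  rewrite -/(multiplier P (A r) theta) rowsD rowsN rows_sum opprB addrC.
  by congr (_ - _); apply: eq_bigr => j _; rewrite rowsZ.
apply/seteqP; split=> theta /= [inTheta primal dual]; split=> //.
- by rewrite primalE -vle_sub0.
- by rewrite dualE -vle0_opp.
- by rewrite vle_sub0 -primalE.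
- by rewrite vle0_opp -dualE.
Qed.
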